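(* Let $n\ge 1$, let $R_1,\dots,R_n$ be commutative rings with identity and, for each $i=1,\dots,n$, let $M_i$ be an $R_i$-module and $S_i$ a multiplicatively closed subset of $R_i$. Let $R=R_1\times\cdots\times R_n$, let $M=M_1\times\cdots\times M_n$ be regarded as an $R$-module, and let $S=S_1\times\cdots\times S_n$, a multiplicatively closed subset of $R$. Let $P=P_1\times\cdots\times P_n$ be a submodule of $M$ (with $P_i$ a submodule of $M_i$). Then the following are equivalent: (a) $P$ is an $S$-primary submodule of $M$. (b) $P_i$ is an $S_i$-primary submodule of $M_i$ for some $i\in\{1,2,\dots,n\}$ and $(P_j:_{R_j}M_j)\cap S_j\neq\emptyset$ for all $j\in\{1,2,\dots,n\}-\{i\}$.
   Context: All rings are commutative with identity and all modules are unital. A multiplicatively closed subset $S$ of a ring $R$ is a non-empty subset with $0\notin S$, $1\in S$, and $ss'\in S$ for all $s,s'\in S$. $(P:_R M)=\{r\in R : rM\subseteq P\}$, and $\sqrt{I}$ is the radical of an ideal $I$. A submodule $P$ of an $R$-module $M$ with $(P:_R M)\cap S=\emptyset$ is called $S$-primary if there exists $s\in S$ such that whenever $rm\in P$ with $r\in R$, $m\in M$, then $sr\in\sqrt{(P:_R M)}$ or $sm\in P$. The product ring acts on the product module componentwise. *)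

(* Defs.v *)
From HB Require Import structures.
From mathcomp Require Import all_boot all_algebra.
From mathcomp Require Import boolp classical_sets.

Set Implicit Arguments.
Unset Strict Implicit.
Unset Printing Implicit Defensive.

Import GRing.Theory.
Local Open Scope classical_set_scope.
Local Open Scope ring_scope.

(* Rings are comPzRingType, so the zero ring is not excluded a priori. *)

Section Notions.
Variable R : comPzRingType.

Definition mult_closed_subset (S : set R) : Prop :=
  [/\ S !=set0, ~ S 0 & GRing.mulr_closed (mem S)].

Definition radical (I : set R) : set R :=
  [set r | exists2 k : nat, (0 < k)%N & I (r ^+ k)].

Variable M : lmodType R.

Definition submodule (P : set M) : Prop := GRing.submod_closed (mem P).

(* (P :_R M) *)
Definition colon (P : set M) : set R := [set r | forall m : M, P (r *: m)].

Definition S_primary (S : set R) (P : set M) : Prop :=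
  [/\ submodule P,
      colon P `&` S = set0
    & exists2 s : R, S s &
        forall (r : R) (m : M), P (r *: m) ->
          radical (colon P) (s * r) \/ P (s *: m)].

End Notions.

(* MathComp's {ffun I -> T} only carries ring and module structures when T does
   not depend on the index; these are the dependent analogues. *)

Definition prod_ring (I : finType) (R : I -> comPzRingType) : Type :=
  {dffun forall i : I, R i}.

Definition prod_mod (I : finType) (R : I -> comPzRingType)
    (M : forall i, lmodType (R i)) : Type :=
  {dffun forall i : I, M i}.

Section ProdRing.
Variables (I : finType) (R : I -> comPzRingType).
Implicit Types x y z : prod_ring R.

HB.instance Definition _ := Choice.copy (prod_ring R) {dffun forall i : I, R i}.

Definition prod_ring_zero : prod_ring R := [ffun i : I => (0 : R i)].
Definition prod_ring_opp x : prod_ring R := [ffun i : I => - x i].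
Definition prod_ring_add x y : prod_ring R := [ffun i : I => x i + y i].
Definition prod_ring_one : prod_ring R := [ffun i : I => (1 : R i)].
Definition prod_ring_mul x y : prod_ring R := [ffun i : I => x i * y i].

Fact prod_ring_addA : associative prod_ring_add.
Proof. by move=> x y z; apply/ffunP=> i; rewrite !ffunE addrA. Qed.
Fact prod_ring_addC : commutative prod_ring_add.
Proof. by move=> x y; apply/ffunP=> i; rewrite !ffunE addrC. Qed.
Fact prod_ring_add0 : left_id prod_ring_zero prod_ring_add.
Proof. by move=> x; apply/ffunP=> i; rewrite !ffunE add0r. Qed.
Fact prod_ring_addN : left_inverse prod_ring_zero prod_ring_opp prod_ring_add.
Proof. by move=> x; apply/ffunP=> i; rewrite !ffunE addNr. Qed.

HB.instance Definition _ := GRing.isZmodule.Build (prod_ring R)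
  prod_ring_addA prod_ring_addC prod_ring_add0 prod_ring_addN.

Fact prod_ring_mulA : associative prod_ring_mul.
Proof. by move=> x y z; apply/ffunP=> i; rewrite !ffunE mulrA. Qed.
Fact prod_ring_mulC : commutative prod_ring_mul.
Proof. by move=> x y; apply/ffunP=> i; rewrite !ffunE mulrC. Qed.
Fact prod_ring_mul1 : left_id prod_ring_one prod_ring_mul.
Proof. by move=> x; apply/ffunP=> i; rewrite !ffunE mul1r. Qed.
Fact prod_ring_mulD : left_distributive prod_ring_mul +%R.
Proof. by move=> x y z; apply/ffunP=> i; rewrite !ffunE mulrDl. Qed.

HB.instance Definition _ := GRing.Zmodule_isComPzRing.Build (prod_ring R)
  prod_ring_mulA prod_ring_mulC prod_ring_mul1 prod_ring_mulD.

End ProdRing.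

Section ProdMod.
Variables (I : finType) (R : I -> comPzRingType) (M : forall i, lmodType (R i)).
Implicit Types (a b : prod_ring R) (x y z : prod_mod M).

HB.instance Definition _ := Choice.copy (prod_mod M) {dffun forall i : I, M i}.

Definition prod_mod_zero : prod_mod M := [ffun i : I => (0 : M i)].
Definition prod_mod_opp x : prod_mod M := [ffun i : I => - x i].
Definition prod_mod_add x y : prod_mod M := [ffun i : I => x i + y i].
Definition prod_mod_scale a x : prod_mod M := [ffun i : I => a i *: x i].

Fact prod_mod_addA : associative prod_mod_add.
Proof. by move=> x y z; apply/ffunP=> i; rewrite !ffunE addrA. Qed.
Fact prod_mod_addC : commutative prod_mod_add.
Proof. by move=> x y; apply/ffunP=> i; rewrite !ffunE addrC. Qed.
Fact prod_mod_add0 : left_id prod_mod_zero prod_mod_add.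
Proof. by move=> x; apply/ffunP=> i; rewrite !ffunE add0r. Qed.
Fact prod_mod_addN : left_inverse prod_mod_zero prod_mod_opp prod_mod_add.
Proof. by move=> x; apply/ffunP=> i; rewrite !ffunE addNr. Qed.

HB.instance Definition _ := GRing.isZmodule.Build (prod_mod M)
  prod_mod_addA prod_mod_addC prod_mod_add0 prod_mod_addN.

Fact prod_mod_scaleA a b x :
  prod_mod_scale a (prod_mod_scale b x) = prod_mod_scale (a * b) x.
Proof. by apply/ffunP=> i; rewrite !ffunE scalerA. Qed.
Fact prod_mod_scale1 : left_id 1 prod_mod_scale.
Proof. by move=> x; apply/ffunP=> i; rewrite !ffunE scale1r. Qed.
Fact prod_mod_scaleDr : right_distributive prod_mod_scale +%R.
Proof. by move=> a x y; apply/ffunP=> i; rewrite !ffunE scalerDr. Qed.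
Fact prod_mod_scaleDl x : {morph prod_mod_scale^~ x : a b / a + b}.
Proof. by move=> a b; apply/ffunP=> i; rewrite !ffunE scalerDl. Qed.

HB.instance Definition _ := GRing.Zmodule_isLmodule.Build (prod_ring R)
  (prod_mod M) prod_mod_scaleA prod_mod_scale1 prod_mod_scaleDr
  prod_mod_scaleDl.

End ProdMod.

Definition prod_ring_set (I : finType) (R : I -> comPzRingType)
    (S : forall i, set (R i)) : set (prod_ring R) :=
  [set x | forall i, S i (x i)].

Definition prod_mod_set (I : finType) (R : I -> comPzRingType)
    (M : forall i, lmodType (R i)) (P : forall i, set (M i)) :
    set (prod_mod M) :=
  [set x | forall i, P i (x i)].

Lemma prod_ring_set_mult_closed (n : nat) (hn : (0 < n)%N)
    (R : 'I_n -> comPzRingType) (S : forall i, set (R i)) :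
  (forall i, mult_closed_subset (S i)) ->
  mult_closed_subset (prod_ring_set S).
Proof.
move=> hS.
have S1 : prod_ring_set S 1.
  by move=> i; rewrite ffunE; have [_ _ []] := hS i; rewrite inE.
split; first by exists 1.
- by move/(_ (Ordinal hn)); rewrite ffunE; have [] := hS (Ordinal hn).
- split; first by rewrite inE.
  move=> x y; rewrite !inE => Sx Sy i; rewrite ffunE.
  have [_ _ [_ /(_ (x i) (y i))]] := hS i; rewrite !inE.
  by apply; [exact: Sx | exact: Sy].
Qed.

Lemma prod_mod_set_submodule (I : finType) (R : I -> comPzRingType)
    (M : forall i, lmodType (R i)) (P : forall i, set (M i)) :
  (forall i, submodule (P i)) -> submodule (prod_mod_set P).
Proof.
move=> hP; split; first by rewrite inE => i; rewrite ffunE; have [] := hP i; rewrite inE.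
move=> a x y; rewrite !inE => Px Py i; rewrite !ffunE.
have [_ /(_ (a i) (x i) (y i))] := hP i; rewrite !inE.
by apply; [exact: Px | exact: Py].
Qed.

(* Main.v *)
Require Import Defs.
From mathcomp Require Import all_boot all_algebra.
From mathcomp Require Import boolp classical_sets.

(** The colon of a product is the product of the colons, so emptiness of
    [colon P `&` S] singles out a factor [i] with [colon (P i) `&` S i] empty.
    Testing primariness on the [i]-th idempotent [e] of the ring and the elements
    [m] with zero [i]-th coordinate, where [e *: m = 0], forces [s *: m] into [P]
    (as [s * e] has no power in the colon); hence [s j] lies in
    [colon (P j) `&` S j] for every other [j]. Conversely, the [i]-th factor's
    witness combined with elements of [colon (P j) `&` S j] is a witness for the
    product. *)

Import GRing.Theory.
Local Open Scope classical_set_scope.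
Local Open Scope ring_scope.

Section Submodules.
Set Implicit Arguments.
Unset Strict Implicit.
Variables (R : comPzRingType) (M : lmodType R).
Implicit Types (S : set R) (P : set M).

Lemma mult_closed_subset_exp S (x : R) (k : nat) :
  mult_closed_subset S -> S x -> S (x ^+ k).
Proof.
move=> [_ _ [S1 SM]] Sx; elim: k => [|k IHk]; first by rewrite inE in S1.
by rewrite exprS; have := SM x (x ^+ k); rewrite !inE; apply.
Qed.

Lemma submodule0 P : submodule P -> P 0.
Proof. by case; rewrite inE. Qed.

Lemma colon_mulr P (a b : R) : colon P a -> colon P (a * b).
Proof. by move=> Pa m; rewrite -scalerA; apply: Pa. Qed.

End Submodules.

Section Products.
Set Implicit Arguments.
Unset Strict Implicit.
Variables (I : finType) (R : I -> comPzRingType) (M : forall i, lmodType (R i)).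
Variables (S : forall i, set (R i)) (P : forall i, set (M i)).
Arguments S : clear implicits.
Arguments P : clear implicits.

(** The inclusion of the [i]-th factor, additive and multiplicative but not unital; [single_ring 1]
    is the [i]-th idempotent. *)
Definition single_ring (i : I) (x : R i) : prod_ring R :=
  [ffun j => dfwith (fun j => 0 : R j) x j].

Definition single_mod (i : I) (x : M i) : prod_mod M :=
  [ffun j => dfwith (fun j => 0 : M j) x j].

Lemma single_ring_in (i : I) (x : R i) : single_ring x i = x.
Proof. by rewrite ffunE dfwith_in. Qed.

Lemma single_ring_out (i j : I) (x : R i) : i != j -> single_ring x j = 0.
Proof. by move=> ij; rewrite ffunE dfwith_out. Qed.

Lemma single_mod_in (i : I) (x : M i) : single_mod x i = x.
Proof. by rewrite ffunE dfwith_in. Qed.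

Lemma single_mod_out (i j : I) (x : M i) : i != j -> single_mod x j = 0.
Proof. by move=> ij; rewrite ffunE dfwith_out. Qed.

Lemma prod_ring_mulE (x y : prod_ring R) (i : I) : (x * y) i = x i * y i.
Proof. by rewrite ffunE. Qed.

Lemma prod_ring_expE (x : prod_ring R) (k : nat) (i : I) :
  (x ^+ k) i = x i ^+ k.
Proof. by elim: k => [|k IHk]; rewrite ?ffunE// !exprS prod_ring_mulE IHk. Qed.

Lemma prod_mod_scaleE (a : prod_ring R) (x : prod_mod M) (i : I) :
  (a *: x) i = a i *: x i.
Proof. by rewrite ffunE. Qed.

(** Each [m] in [M i] is the [i]-th coordinate of [single_mod m], so a condition on all tuples tests
    every factor separately. *)
Lemma colon_prod (r : prod_ring R) :
  colon (prod_mod_set P) r <-> forall i, colon (P i) (r i).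
Proof.
split=> [Pr i m|Pr m i]; last by rewrite prod_mod_scaleE; apply: Pr.
by have := Pr (single_mod m) i; rewrite prod_mod_scaleE single_mod_in.
Qed.

Lemma radical_colon_prod (r : prod_ring R) (i : I) :
  radical (colon (prod_mod_set P)) r -> radical (colon (P i)) (r i).
Proof.
by case=> k k0 /colon_prod /(_ i); rewrite prod_ring_expE; exists k.
Qed.

Hypothesis hS : forall i, mult_closed_subset (S i).
Hypothesis hP : forall i, submodule (P i).

Lemma prod_colon_meet :
  (forall i, (colon (P i) `&` S i) !=set0) ->
  (colon (prod_mod_set P) `&` prod_ring_set S) !=set0.
Proof.
move=> meet; pose t : prod_ring R := [ffun i => projT1 (cid (meet i))].
exists t; split; first apply/colon_prod; move=> i; rewrite ffunE;
  by case: (cid (meet i)) => ? [].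
Qed.

Lemma S_primary_prod_factor :
  S_primary (prod_ring_set S) (prod_mod_set P) ->
  exists i, S_primary (S i) (P i) /\
    forall j, j <> i -> (colon (P j) `&` S j) !=set0.
Proof.
move=> [_ PS0 [s Ss primary]].
have [i PiSi0] : exists i, colon (P i) `&` S i = set0.
  apply: contrapT => /forallNP nPS.
  have [|x] := prod_colon_meet; last by rewrite PS0.
  by move=> i; apply/set0P/eqP/nPS.
exists i; split=> [|j /eqP ji].
  split=> //; exists (s i) => [|r m Prm]; first exact: Ss.
  (* Both elements are supported at [i], so their product is [r *: m] at [i] and zero, hence in
     [P j], elsewhere. *)
  have [j|rad|Psm] := primary (single_ring r) (single_mod m).
  - rewrite prod_mod_scaleE; have [<-|ij] := eqVneq i j.
      by rewrite single_ring_in single_mod_in.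
    by rewrite single_mod_out// scaler0; apply: submodule0.
  - left; have := radical_colon_prod i rad.
    by rewrite prod_ring_mulE single_ring_in.
  - by right; have := Psm i; rewrite prod_mod_scaleE single_mod_in.
exists (s j); split=> [m|]; last exact: Ss.
have [l|rad|Psm] := primary (single_ring (1 : R i)) (single_mod m).
- rewrite prod_mod_scaleE; have [<-|il] := eqVneq i l.
    by rewrite single_mod_out// scaler0; apply: submodule0.
  by rewrite single_ring_out// scale0r; apply: submodule0.
(* The [i]-th coordinate of [s * e] is [s i], whose powers stay in [S i] and so avoid
   [colon (P i)]. *)
- have [k _] := radical_colon_prod i rad.
  rewrite prod_ring_mulE single_ring_in mulr1 => Psk.
  suff : (colon (P i) `&` S i) (s i ^+ k) by rewrite PiSi0.
  by split=> //; apply: mult_closed_subset_exp (hS i) (Ss i).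
- by have := Psm j; rewrite prod_mod_scaleE single_mod_in.
Qed.

Lemma S_primary_factor_prod (i : I) :
  S_primary (S i) (P i) ->
  (forall j, j <> i -> (colon (P j) `&` S j) !=set0) ->
  S_primary (prod_ring_set S) (prod_mod_set P).
Proof.
move=> [_ PiSi0 [s Ss primary]] meet.
(* Guarding by [j <> i] makes the choice total; the dummy value [0] at [i] is overwritten by [s] in
   [t] below. *)
have meet' j : exists t : R j, j <> i -> (colon (P j) `&` S j) t.
  by have [->|/eqP/meet[t ?]] := eqVneq j i; [exists 0|exists t].
pose t : prod_ring R := [ffun j => dfwith (fun j => projT1 (cid (meet' j))) s j].
have ti : t i = s by rewrite ffunE dfwith_in.
have tj j : i != j -> (colon (P j) `&` S j) (t j).
  move=> ij; rewrite ffunE dfwith_out//; case: cid => /= x; apply.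
  by move=> ji; rewrite ji eqxx in ij.
split; first exact: prod_mod_set_submodule.
  rewrite -subset0 => r [/colon_prod Pr Sr].
  by suff : (colon (P i) `&` S i) (r i) by rewrite PiSi0.
exists t => [j|r m Prm].
  by have [<-|/tj[]//] := eqVneq i j; rewrite ti.
have [|[k k0 Psrk]|Psm] := primary (r i) (m i).
- by rewrite -prod_mod_scaleE; apply: Prm.
- left; exists k => //; apply/colon_prod => j.
  rewrite prod_ring_expE prod_ring_mulE.
  have [<-|/tj[Pt _]] := eqVneq i j; first by rewrite ti.
  (* The exponent found at [i] serves every coordinate: as it is positive, a factor [t j] in
     [colon (P j)] splits off the power. *)
  by case: k k0 {Psrk} => // k _; rewrite exprS -mulrA; apply: colon_mulr.
- right=> j; rewrite prod_mod_scaleE.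
  (* Away from [i], [t j] sends all of [M j] into [P j]. *)
  by have [<-|/tj[Pt _]] := eqVneq i j; [rewrite ti|apply: Pt].
Qed.

End Products.

Theorem theorem2p21 (n : nat) (hn : (1 <= n)%N)
    (R : 'I_n -> comPzRingType) (M : forall i : 'I_n, lmodType (R i))
    (S : forall i : 'I_n, set (R i)) (P : forall i : 'I_n, set (M i))
    (hS : forall i : 'I_n, mult_closed_subset (S i))
    (hP : forall i : 'I_n, submodule (P i)) :
  S_primary (prod_ring_set S) (prod_mod_set P) <->
  exists i : 'I_n,
    S_primary (S i) (P i) /\
    forall j : 'I_n, j <> i -> (colon (P j) `&` S j) !=set0.
Proof.
split; first exact: S_primary_prod_factor.
by move=> [i [Pi meet]]; apply: S_primary_factor_prod Pi meet.
Qed.
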